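(* The diameter of the graph $\mathcal{G}$ equals $3$; that is, $d(\mathcal{G})=3$.
   Context: $\mathcal{G}$ is the infinite undirected graph with vertex set $V(\mathcal{G})=\mathbb{Z}^2$, in which two vertices $A=(x_1,y_1)$ and $B=(x_2,y_2)$ are joined by an edge if and only if $x_1\neq x_2$, $y_1\neq y_2$, and the Euclidean distance $|AB|=\sqrt{(x_1-x_2)^2+(y_1-y_2)^2}$ is an integer. For vertices $A,B$, $d(A,B)$ denotes the graph distance, i.e. the length (number of edges) of a shortest path from $A$ to $B$ in $\mathcal{G}$. The diameter $d(\mathcal{G})$ is the maximum of $d(A,B)$ over all pairs of vertices $A,B$ (in particular, the claim includes that this maximum exists). *)

(* Defs.v *)
From Stdlib Require Import Reals ZArith List Arith Rgeom.

Definition vertex : Type := (Z * Z)%type.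

Definition euclid_dist (A B : vertex) : R :=
  dist_euc (IZR (fst A)) (IZR (snd A)) (IZR (fst B)) (IZR (snd B)).

Definition adj (A B : vertex) : Prop :=
  fst A <> fst B /\ snd A <> snd B /\ exists n : Z, euclid_dist A B = IZR n.

Lemma adj_irrefl (A : vertex) : ~ adj A A.
Proof. intros [H _]; now apply H. Qed.

Lemma adj_sym (A B : vertex) : adj A B -> adj B A.
Proof.
  intros [Hx [Hy [n Hn]]]; repeat split; auto; exists n.
  rewrite <- Hn; unfold euclid_dist; apply distance_symm.
Qed.

Fixpoint is_walk {V : Type} (E : V -> V -> Prop) (A : V) (p : list V) : Prop :=
  match p with
  | nil => True
  | B :: q => E A B /\ is_walk E B q
  end.

(* A path is encoded by its start [A] and the list [p] of the vertices that
   follow, so that [length p] is its number of edges. *)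
Definition is_path {V : Type} (E : V -> V -> Prop) (A B : V) (p : list V) : Prop :=
  is_walk E A p /\ last p A = B /\ NoDup (A :: p).

(* [graph_dist E A B n] reads d(A,B) = n. It holds for no [n] if [A] and [B]
   are not connected. *)
Definition graph_dist {V : Type} (E : V -> V -> Prop) (A B : V) (n : nat) : Prop :=
  (exists p, is_path E A B p /\ length p = n) /\
  (forall p, is_path E A B p -> n <= length p).

Lemma graph_dist_unique {V : Type} (E : V -> V -> Prop) (A B : V) (m n : nat) :
  graph_dist E A B m -> graph_dist E A B n -> m = n.
Proof.
  intros [[p [Hp <-]] Hm] [[q [Hq <-]] Hn].
  apply Nat.le_antisymm; auto.
Qed.

(* The distances form a set with maximum [n]; in particular every pair of
   vertices has a finite distance. *)
Definition has_diameter {V : Type} (E : V -> V -> Prop) (n : nat) : Prop :=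
  (exists A B, graph_dist E A B n) /\
  (forall A B, exists m, graph_dist E A B m /\ m <= n).

(* Main.v *)
(** Modulo the lattice {(x,y) : 7 | x + y}, which is spanned by (3,4) and (4,3),
    the vector (5,12) generates Z^2, so every integer vector is a combination
    k(3,4) + l(4,3) + m(5,12). The solutions (k,l,m) form a line, and all but
    finitely many of its points have no zero coordinate; hence any two vertices
    are joined by a walk of length 3.
    Conversely, (0,0) and (1,0) have no common neighbour: a nondegenerate
    triangle with integer sides, one of which is 1, is isosceles with apex
    above the midpoint of that side, and here this apex is not integral. *)
From Stdlib Require Import Reals Rgeom ZArith List Lia Wf_nat Classical.
Require Import Defs.
Import ListNotations.

Lemma last_cons {V : Type} (A B : V) (q : list V) : last (B :: q) A = last q B.
Proof.
  revert A B; induction q as [|C q IH]; intros A B; [reflexivity|].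
  transitivity (last (C :: q) A); [reflexivity|now rewrite !IH].
Qed.

Lemma path_suffix {V : Type} (E : V -> V -> Prop) (A B C : V) (p : list V) :
  is_path E A B p -> In C (A :: p) ->
  exists q, is_path E C B q /\ length q <= length p.
Proof.
  revert A; induction p as [|D p IH]; intros A Hp HC.
  - destruct HC as [<-|[]]; exists []; auto.
  - destruct HC as [<-|HC]; [exists (D :: p); auto|].
    destruct Hp as [[_ Hw] [Hl Hd]].
    destruct (IH D) as [q [Hq Hle]]; [|assumption|exists q; simpl; auto].
    repeat split; [assumption|now rewrite last_cons in Hl|now inversion Hd].
Qed.

(** Loops are cut out by induction: when the start recurs on the path obtained for the tail, the
    suffix from that occurrence replaces it. *)
Lemma walk_path {V : Type} (E : V -> V -> Prop) (A B : V) (p : list V) :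
  is_walk E A p -> last p A = B ->
  exists q, is_path E A B q /\ length q <= length p.
Proof.
  revert A; induction p as [|C p IH]; intros A Hw Hl.
  - exists []; repeat split; auto; constructor; [intros []|constructor].
  - destruct Hw as [HE Hw]; rewrite last_cons in Hl.
    destruct (IH C Hw Hl) as [q [Hq Hle]].
    destruct (classic (In A (C :: q))) as [HA|HA].
    + destruct (path_suffix E C B A q Hq HA) as [r [Hr Hle']].
      exists r; simpl; split; [assumption|lia].
    + exists (C :: q); simpl; split; [|lia].
      destruct Hq as [Hqw [Hql Hqd]].
      repeat split; [assumption..|now rewrite last_cons|now constructor].
Qed.

Lemma walk_graph_dist {V : Type} (E : V -> V -> Prop) (A B : V) (p : list V) :
  is_walk E A p -> last p A = B ->
  exists m, graph_dist E A B m /\ m <= length p.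
Proof.
  intros Hw Hl; destruct (walk_path E A B p Hw Hl) as [q [Hq Hle]].
  destruct (dec_inh_nat_subset_has_unique_least_element
              (fun n => exists r, is_path E A B r /\ length r = n))
    as [m [[Hm Hmin] _]].
  - intro n; apply classic.
  - now exists (length q), q.
  - assert (Hpath : forall r, is_path E A B r -> m <= length r)
      by (intros r Hr; apply Hmin; now exists r).
    exists m; split; [now split|].
    specialize (Hpath q Hq); lia.
Qed.

Lemma adj_iff (x1 y1 x2 y2 : Z) :
  adj (x1, y1) (x2, y2) <->
  (x1 <> x2 /\ y1 <> y2 /\
   exists n, 0 <= n /\ (x1 - x2) * (x1 - x2) + (y1 - y2) * (y1 - y2) = n * n)%Z.
Proof.
  unfold adj, euclid_dist, dist_euc, Rsqr; simpl.
  rewrite <- !minus_IZR, <- !mult_IZR, <- plus_IZR.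
  split; intros [Hx [Hy [n Hn]]]; (split; [assumption|split; [assumption|]]);
    exists n.
  - split.
    + apply le_IZR; rewrite <- Hn; apply sqrt_pos.
    + apply eq_IZR; rewrite (mult_IZR n n), <- Hn, sqrt_sqrt; [reflexivity|].
      apply IZR_le; nia.
  - destruct Hn as [Hn ->].
    rewrite mult_IZR; apply sqrt_square, IZR_le, Hn.
Qed.

Lemma adj_translate (x y k p q r : Z) :
  (k <> 0 -> p <> 0 -> q <> 0 -> p * p + q * q = r * r ->
   adj (x, y) (x + k * p, y + k * q))%Z.
Proof.
  intros Hk Hp Hq Hr; apply adj_iff.
  split; [nia|split; [nia|]].
  (* [k] and [r] may be negative, whereas [adj_iff] asks for a nonnegative root. *)
  exists (Z.abs (k * r)); split; [lia|].
  rewrite Z.abs_square; nia.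
Qed.

Lemma three_direction_decomposition (a b : Z) :
  exists k l m, (k <> 0 /\ l <> 0 /\ m <> 0 /\
    a = k * 3 + l * 4 + m * 5 /\ b = k * 4 + l * 3 + m * 12)%Z.
Proof.
  (* The terms in [a], [b] below form a particular solution, and (-33,16,7) spans the integer
     relations among the three vectors. [t] exceeds each particular coordinate in absolute value, so
     none of the sums vanishes. *)
  pose (t := (1 + Z.abs (24 * a + 23 * b) + Z.abs (12 * a + 11 * b)
                + Z.abs (5 * (a + b)))%Z).
  exists (- (24 * a + 23 * b) - 33 * t)%Z, (12 * a + 11 * b + 16 * t)%Z,
    (5 * (a + b) + 7 * t)%Z.
  unfold t; repeat split; lia.
Qed.

Lemma adj_dist_le_3 (A B : vertex) : exists m, graph_dist adj A B m /\ m <= 3.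
Proof.
  destruct A as [x y], B as [x' y'].
  destruct (three_direction_decomposition (x' - x) (y' - y))
    as [k [l [m [Hk [Hl [Hm [Hx Hy]]]]]]].
  apply (walk_graph_dist adj (x, y) (x', y')
    [(x + k * 3, y + k * 4)%Z;
     (x + k * 3 + l * 4, y + k * 4 + l * 3)%Z;
     (x + k * 3 + l * 4 + m * 5, y + k * 4 + l * 3 + m * 12)%Z]).
  - split; [|split; [|split; [|exact I]]].
    + apply (adj_translate _ _ _ _ _ 5); lia.
    + apply (adj_translate _ _ _ _ _ 5); lia.
    + apply (adj_translate _ _ _ _ _ 13); lia.
  - simpl; f_equal; lia.
Qed.

Lemma no_common_neighbour (C : vertex) :
  adj (0, 0)%Z C -> adj C (1, 0)%Z -> False.
Proof.
  destruct C as [x y]; rewrite !adj_iff.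
  intros [_ [Hy [z [Hz Ez]]]] [_ [_ [w [Hw Ew]]]].
  (* Both bounds are strict because [y] is nonzero. *)
  assert (Hzx : (Z.abs x < z)%Z) by nia.
  assert (Hwx : (Z.abs (x - 1) < w)%Z) by nia.
  assert (E : ((z - w) * (z + w) = 2 * x - 1)%Z) by nia.
  (* Equality fails by parity. Otherwise |z - w| >= 1 bounds z + w by |2x - 1| = |x| + |x - 1|,
     against the strict bounds. *)
  destruct (Z.eq_dec z w) as [->|Hne]; [lia|].
  assert (z + w <= Z.abs (2 * x - 1))%Z by (rewrite <- E; nia).
  lia.
Qed.

Theorem theorem1 : has_diameter adj 3.
Proof.
  split; [|exact adj_dist_le_3].
  exists (0, 0)%Z, (1, 0)%Z.
  destruct (adj_dist_le_3 (0, 0)%Z (1, 0)%Z) as [m [Hm Hle]].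
  replace 3 with m; [assumption|].
  destruct Hm as [[p [[Hw [Hl _]] <-]] _].
  (* Lengths 0, 1 and 2 fail: the endpoints differ, share their ordinate, and have no common
     neighbour. Beyond that, [Hle] forces length 3. *)
  destruct p as [|C [|D [|F p]]]; simpl in *.
  - discriminate.
  - subst C; destruct Hw as [[_ [Hy _]] _]; now contradict Hy.
  - subst D; destruct Hw as [HC [HD _]].
    destruct (no_common_neighbour C HC HD).
  - lia.
Qed.
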